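(* Let $\mathcal G$ be a ribbon graph with half-edges with topological medial graph $\mathcal G_m$. Let $\mathfrak R$ be a commutative unitary ring, $a,b,d\in\mathfrak R$, and let the weight system $(\boldsymbol\alpha,\boldsymbol\eta)$ on $\mathcal G_m$ be constant: $\alpha_v=\alpha$ and $\eta_v=\eta$ for all vertices $v$ of $\mathcal G_m$, where $\alpha,\eta,a$ are invertible in $\mathfrak R$. Then $$Q(\mathcal G;(\boldsymbol\alpha,\boldsymbol\eta),a,b,d)=\alpha^{\mathrm r(\mathcal G)}\,\eta^{n(\mathcal G)}\,a^{k(\mathcal G)}\;\mathcal R\Big(\mathcal G;\ X=\tfrac{\eta a}{\alpha}+1,\ Y=\tfrac{\alpha a}{\eta}+1,\ Z=\tfrac1a,\ S=d,\ T=b,\ W=1\Big).$$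
   Context: Ribbon graphs with half-edges. A ribbon graph is a surface with boundary presented as a union of vertex discs and edge ribbons. A half-ribbon (HR, or half-edge) is a ribbon attached to a unique vertex by one end segment, its other end segment being free; the end-points of the free segment are its external points. A ribbon graph with half-edges is a ribbon graph $\mathcal G(\mathcal V,\mathcal E,\mathfrak f^0)$ with a set $\mathfrak f^0$ of HRs attached to its vertices; equivalently, a graph with half-edges cellularly embedded in a surface with punctures, each half-edge ending at a puncture. Cutting an edge $e$ (giving $\mathcal G\vee e$) removes $e$ and leaves one HR at each of the two places where $e$ was attached. An internal face is a boundary component never passing through a free segment of a HR; an external face is a boundary piece leaving an external point of some HR and rejoining another external point. The boundary graph has one vertex per HR and one edge per external face. Polynomial $\mathcal R$. A spanning c-subgraph $A\Subset\mathcal G$ is obtained by cutting a subset of the edges of $\mathcal G$ (keeping all vertices and all HRs, plus the HRs created by the cuts). Define $$\mathcal R(\mathcal G;X,Y,Z,S,W,T)=\sum_{A\Subset\mathcal G}(X-1)^{\mathrm r(\mathcal G)-\mathrm r(A)}(Y-1)^{n(A)}Z^{k(A)-F_{\rm int}(A)+n(A)}S^{C_\partial(A)}W^{t(A)}T^{f(A)}$$ in $\mathbb Z[X,Y,Z,S,W,T]/(W^2-W)$, where $k(A)$ is the number of connected components, $\mathrm r(A)=|\mathcal V|-k(A)$, $n(A)=|\mathcal E(A)|-\mathrm r(A)$, $F_{\rm int}(A)$ the number of internal faces, $C_\partial(A)$ the number of connected components of the boundary graph, $f(A)$ the number of HRs of $A$, and $t(A)=0$ if $A$ is orientable, $t(A)=1$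 otherwise. Medial graph. $\mathcal G_m$ is constructed by placing a vertex $v_e$ of degree 4 on each edge $e$ of $\mathcal G$, a ''fictitious'' vertex of degree 2 at the free end of each half-edge, drawing the edges of the medial graph by following the face boundaries of $\mathcal G$, and finally removing the vertices of degree 2 (leaving pairs of loose ends). The medial graph of an isolated vertex is an isolated closed curve; that of an edgeless vertex with $n\ge1$ half-edges is a collection of $n$ open curves between $n$ fictitious vertices. In the canonical checkerboard coloring the faces of $\mathcal G_m$ containing a vertex of $\mathcal G$ are black and the others white. States. At a vertex $v_e$ of $\mathcal G_m$ the states used are: the white smoothing (''uncut'' state), where the two arcs run along the two sides of $e$, joining the black regions at the two ends of $e$ (it corresponds to contracting $e$); and the cutting state, obtained from the black smoothing (whose two arcs separate the two black regions, corresponding to deletion of $e$) by cutting both arcs (it corresponds to $\mathcal G\vee e$), each cut arc being memorized by a fictitious vertex of degree 2 joining the two loose ends. A graph state $S$ is a choice of one of these two states at each vertex of $\mathcal G_m$. Let $c(S)$ be the number of closed components of $S$, $c'(S)$ the number of open components (open curves), and $c''(S)$ the number of punctured curves: closed curves with at least one fictitious vertex obtained when all fictitious degree-2 vertices (from half-edges of $\mathcal G$ and from cutting states) are reinserted so as to glue the open curves together. Transition polynomial. A weight system $(\boldsymbol\alpha,\boldsymbol\eta)$ assigns to each vertex $v$ of $\mathcal G_m$ the weight $\alpha_v\in\mathfrak R$ for the white smoothing and $\eta_v\in\mathfrak R$ for the cutting state (all other vertex states have weight 0). With $w(S)=\prod_v w(v,S)$ the product of the weights of the chosen vertex states, $$Q(\mathcal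 G;(\boldsymbol\alpha,\boldsymbol\eta),a,b,d)=\sum_S w(S)\,a^{c(S)}b^{c'(S)}d^{c''(S)}.$$ *)

(* Defs.v *)
From HB Require Import structures.
From mathcomp Require Import all_boot all_order all_algebra.
From mathcomp Require Import mpoly.

Set Implicit Arguments.
Unset Strict Implicit.
Unset Printing Implicit Defensive.

Import GRing.Theory.
Local Open Scope ring_scope.

(* Meaningful when [e] is symmetric and [D] is closed under [e], as in all the
   uses below. *)
Definition components (T : finType) (e : rel T) (D : {set T}) : {set {set T}} :=
  equivalence_partition (connect e) D.

(* Ribbon graphs with half-edges, orientable or not, encoded by flags.  Every
   ribbon (edge or half-ribbon) meets the boundary of a vertex disc along one
   (half-ribbon) or two (edge) segments; a flag is an end-point of such a
   segment.  Equivalently, a flag is one end of a long side of an edge ribbon, or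
   a long side of a half-ribbon, and hence also an external point of the latter.
   - [across] goes to the other end-point of the same attaching segment;
   - [around] goes to the other end-point of the arc of the boundary of the
     vertex disc that leaves the segment at the flag;
   - [along] goes to the other end of the same long side of an edge ribbon; the
     fixed points of [along] are the flags of the half-ribbons.
   The last axiom says that the boundary of a vertex disc is a single circle,
   alternating between attaching segments and arcs.  Vertices outside the
   image of [at_vertex] are discs without ribbons. *)
Record ribbon_graph := RibbonGraph {
  vertex : finType;
  flag : finType;
  at_vertex : flag -> vertex;
  along : flag -> flag;
  across : flag -> flag;
  around : flag -> flag;
  alongK : involutive along;
  acrossK : involutive across;
  aroundK : involutive around;
  across_neq : forall x, across x != x;
  around_neq : forall x, around x != x;
  along_acrossC : forall x, along (across x) = across (along x);
  along_neq_across : forall x, along x != across x;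
  at_vertexP : forall x y, (at_vertex x == at_vertex y) =
    connect [rel u v | (v == across u) || (v == around u)] x y
}.

Section RibbonGraph.

Variable G : ribbon_graph.
Implicit Types x y : flag G.

Definition ribbon x : {set flag G} :=
  [set x; along x; across x; along (across x)].

Definition is_edge (r : {set flag G}) : bool :=
  [exists x, (along x != x) && (r == ribbon x)].

Definition edge : finType := {r : {set flag G} | is_edge r}.

(* [None] on the flags of half-ribbons. *)
Definition edge_at x : option edge := insub (ribbon x).

Definition half_ribbons : {set {set flag G}} :=
  [set ribbon x | x : flag G & along x == x].

Definition isolated : {set vertex G} := [set v | v \notin codom (@at_vertex G)].

Definition adjacent : rel (vertex G) :=
  [rel u v | [exists x, (at_vertex x == u) && (at_vertex (along x) == v)]].

Definition ncomp : nat := #|components adjacent [set: vertex G]|.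

(* The truncated subtractions here and in [Rpoly] never truncate. *)
Definition rank : nat := (#|vertex G| - ncomp)%N.

Definition nullity : nat := (#|edge| - rank)%N.

(* Connected pieces of the boundary of the surface once the free segments of
   the half-ribbons are removed; the boundary circle of an isolated vertex
   carries no flag and is accounted for in [nint_faces]. *)
Definition boundary_pieces : {set {set flag G}} :=
  components [rel x y | (y == along x) || (y == around x)] [set: flag G].

Definition external_faces : {set {set flag G}} :=
  [set C in boundary_pieces | [exists x in C, along x == x]].

Definition nint_faces : nat :=
  (#|boundary_pieces :\: external_faces| + #|isolated|)%N.

(* Boundary graph: its vertices are the half-ribbons, its edges the external
   faces; a face is incident to the half-ribbons having an external point on
   it. *)
Definition boundary_adjacent : rel {set flag G} :=
  [rel h k | [&& h \in half_ribbons, k \in half_ribbons &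
    [exists C in external_faces, (h :&: C != set0) && (k :&: C != set0)]]].

Definition nboundary_comp : nat :=
  #|components boundary_adjacent half_ribbons|.

Definition nhalf_ribbons : nat := #|half_ribbons|.

(* An orientation is a 2-colouring of the flags telling at which end-points the
   oriented boundary of a disc or ribbon enters an attaching segment. *)
Definition orientable : bool :=
  [exists o : {ffun flag G -> bool}, [forall x,
    [&& o (across x) == ~~ o x, o (around x) == ~~ o x &
        (along x != x) ==> (o (along x) == ~~ o x)]]].

Definition nonorientability : nat := ~~ orientable.

Lemma ribbon_along x : ribbon (along x) = ribbon x.
Proof.
apply/setP=> y; rewrite !inE alongK -along_acrossC alongK.
by do 4!case: (y == _).
Qed.

Lemma ribbon_across x : ribbon (across x) = ribbon x.
Proof.
apply/setP=> y; rewrite !inE acrossK.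
by do 4!case: (y == _).
Qed.

Section Cut.

Variable B : {set edge}.

Definition is_cut x : bool := if edge_at x is Some e then e \in B else false.

Definition cut_along x : flag G := if is_cut x then x else along x.

Lemma is_cut_along x : is_cut (along x) = is_cut x.
Proof. by rewrite /is_cut /edge_at ribbon_along. Qed.

Lemma is_cut_across x : is_cut (across x) = is_cut x.
Proof. by rewrite /is_cut /edge_at ribbon_across. Qed.

Lemma cut_alongK : involutive cut_along.
Proof.
move=> x; rewrite /cut_along; case E: (is_cut x); rewrite ?is_cut_along E //.
exact: alongK.
Qed.

Lemma cut_along_acrossC x : cut_along (across x) = across (cut_along x).
Proof.
by rewrite /cut_along is_cut_across; case: ifP => // _; exact: along_acrossC.
Qed.

Lemma cut_along_neq_across x : cut_along x != across x.
Proof.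
rewrite /cut_along; case: ifP => _; last exact: along_neq_across.
by rewrite eq_sym across_neq.
Qed.

(* The ribbon graph obtained by cutting the edges in [B]. *)
Definition cut : ribbon_graph :=
  @RibbonGraph (vertex G) (flag G) (@at_vertex G)
    cut_along (@across G) (@around G)
    cut_alongK (@acrossK G) (@aroundK G) (@across_neq G) (@around_neq G)
    cut_along_acrossC cut_along_neq_across (@at_vertexP G).

End Cut.

End RibbonGraph.

(* Z[X,Y,Z,S,W,T]/(W^2-W), as polynomials in W over Z[X,Y,Z,S,T] modulo
   W^2 - W. *)
Definition ZXYZST : comNzRingType := {mpoly int[5]}.
Definition W2W : {poly ZXYZST} := 'X^2 - 'X.
Definition Rring : comNzRingType := {poly %/ W2W}.

Definition Rconst (p : ZXYZST) : Rring := in_qpoly W2W p%:P.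
Definition varX : Rring := Rconst ('X_(inord 0) : {mpoly int[5]}).
Definition varY : Rring := Rconst ('X_(inord 1) : {mpoly int[5]}).
Definition varZ : Rring := Rconst ('X_(inord 2) : {mpoly int[5]}).
Definition varS : Rring := Rconst ('X_(inord 3) : {mpoly int[5]}).
Definition varT : Rring := Rconst ('X_(inord 4) : {mpoly int[5]}).
Definition varW : Rring := in_qpoly W2W 'X.

Definition Rpoly (G : ribbon_graph) : Rring :=
  \sum_(B : {set edge G}) let A := cut B in
    (varX - 1) ^+ (rank G - rank A)%N * (varY - 1) ^+ nullity A *
    varZ ^+ (ncomp A + nullity A - nint_faces A)%N *
    varS ^+ nboundary_comp A * varW ^+ nonorientability A *
    varT ^+ nhalf_ribbons A.

(* Evaluation at X = x, ..., T = t.  An element of [Rring] is its representative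
   of degree at most 1 in W, so that this respects products exactly when
   w ^+ 2 = w; see [Reval_is_monoid_morphism]. *)
Definition Reval (R : comNzRingType) (x y z s w t : R) (P : Rring) : R :=
  (map_poly (mmap intr (fun i : 'I_5 => [:: x; y; z; s; t]`_i) : ZXYZST -> R)
     (P : {poly ZXYZST})).[w].

Lemma W2W_monic : W2W \is monic.
Proof.
by rewrite monicE /W2W lead_coefDl ?lead_coefXn // size_polyN size_polyX size_polyXn.
Qed.

Lemma mk_monic_W2W : mk_monic W2W = W2W.
Proof.
rewrite /mk_monic W2W_monic /W2W size_polyDl ?size_polyXn //.
by rewrite size_polyN size_polyX.
Qed.

Section RevalMorphism.

Variables (R : comNzRingType) (x y z s w t : R).

Lemma Reval_is_monoid_morphism :
  w ^+ 2 = w -> monoid_morphism (Reval x y z s w t).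
Proof.
move=> w_idem; split=> [|p q]; rewrite /Reval /=.
  by rewrite rmorph1 hornerC.
have mW : mk_monic W2W \is monic by exact: monic_mk_monic.
have ev0 : (map_poly (mmap intr (fun i : 'I_5 => [:: x; y; z; s; t]`_i)
    : ZXYZST -> R) (mk_monic W2W)).[w] = 0.
  rewrite mk_monic_W2W rmorphB /= map_polyXn map_polyX.
  by rewrite hornerD hornerN hornerXn hornerX w_idem subrr.
rewrite -hornerM -rmorphM /=.
rewrite [in RHS](Pdiv.RingMonic.rdivp_eq mW ((p : {poly _}) * q)).
by rewrite rmorphD hornerD rmorphM hornerM /= ev0 mulr0 add0r.
Qed.

End RevalMorphism.

(* Checkerboard-coloured medial graphs, after removal of the vertices of degree
   2.  [mend] is the type of the ends of the edges of the medial graph, and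
   [mopposite] goes to the other end of the same edge.  An end lies either at a
   vertex of degree 4, given by [mvertex_at], or is loose ([None]).  At a vertex of
   degree 4, [mwhite] and [mblack] pair the four ends as the arcs of the white
   and of the black smoothing do; [mfictitious] pairs the two loose ends left by
   the same fictitious vertex.  [mloops] is the number of isolated closed
   curves. *)
Record medial_graph := MedialGraph {
  mvertex : finType;
  mend : finType;
  mvertex_at : mend -> option mvertex;
  mopposite : mend -> mend;
  mwhite : mend -> mend;
  mblack : mend -> mend;
  mfictitious : mend -> mend;
  mloops : nat
}.

(* An edge of the medial graph follows one arc of a vertex disc between two
   attaching segments, and is continued along the side of the ribbon at each
   end: the ends are the flags.  The white arcs run along the sides of an edge,
   the black arcs across it, and a fictitious vertex joins the two sides of a
   half-ribbon at its free end. *)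
Definition medial (G : ribbon_graph) : medial_graph :=
  @MedialGraph (edge G) (flag G) (@edge_at G) (@around G) (@along G)
    (@across G) (@across G) #|isolated G|.

Section States.

Variable M : medial_graph.

(* A state is the set of the vertices in the white (uncut) state, all the
   others being in the cutting state. *)
Definition state : finType := {set mvertex M}.

Implicit Type S : state.

Definition joined S (x : mend M) : bool :=
  if mvertex_at x is Some v then v \in S else false.

Definition state_rel S : rel (mend M) :=
  [rel x y | (y == mopposite x) || joined S x && (y == mwhite x)].

Definition state_curves S : {set {set mend M}} :=
  components (state_rel S) [set: mend M].

Definition open_curves S : {set {set mend M}} :=
  [set C in state_curves S | [exists x in C, ~~ joined S x]].

Definition nclosed S : nat :=
  (#|state_curves S :\: open_curves S| + mloops M)%N.

Definition nopen S : nat := #|open_curves S|.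

(* The fictitious vertex reinserted at a loose end glues it to the other half of
   the black arc that has been cut, or to the other loose end at the same
   half-edge. *)
Definition glue (x : mend M) : mend M :=
  if mvertex_at x is Some _ then mblack x else mfictitious x.

Definition punctured_rel S : rel (mend M) :=
  [rel x y | state_rel S x y || ~~ joined S x && (y == glue x)].

Definition npunctured S : nat :=
  #|[set C in components (punctured_rel S) [set: mend M] |
      [exists x in C, ~~ joined S x]]|.

Definition state_weight (R : comNzRingType) (alpha eta : mvertex M -> R) S : R :=
  \prod_v (if v \in S then alpha v else eta v).

Definition transition (R : comNzRingType) (alpha eta : mvertex M -> R)
    (a b d : R) : R :=
  \sum_S state_weight alpha eta S *
    a ^+ nclosed S * b ^+ nopen S * d ^+ npunctured S.

End States.

Definition Qpoly (G : ribbon_graph) (R : comNzRingType)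
    (alpha eta : mvertex (medial G) -> R) (a b d : R) : R :=
  transition alpha eta a b d.

(* Main.v *)
Require Import Defs.
From mathcomp Require Import all_boot all_order all_algebra.
From mathcomp Require Import zify ring.
From mathcomp Require Import mpoly.

Set Implicit Arguments.
Unset Strict Implicit.
Unset Printing Implicit Defensive.

Import GRing.Theory.

(* A state with set [S] of uncut vertices corresponds to the spanning c-subgraph
   cutting the edges outside [S], and the two sums agree term by term.  Closed
   curves are internal faces and open curves are external faces; there are as
   many of the latter as half-ribbons, since each of the two external points of
   a half-ribbon is one of the two ends of an open curve.  Punctured curves are
   the components of the boundary graph.  It remains to compare exponents, which
   requires that no truncated subtraction truncates; the only substantial point
   is [F_int(A) <= k(A) + n(A)], that is, nonnegativity of the Euler genus, by
   induction on the number of uncut edges. *)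

(** * Components of finite relations *)

Section FiniteSets.

Variables (T T' T'' : finType).

(** Both images index the classes of one equivalence on [D]. They are compared through the image of
    [x |-> (f x, g x)], on which both projections are injective. *)
Lemma card_imset_eq (f : T -> T') (g : T -> T'') (D : {set T}) :
  {in D &, forall x y, (f x == f y) = (g x == g y)} -> #|f @: D| = #|g @: D|.
Proof.
move=> fg; pose h x := (f x, g x).
have fE : f @: D = fst @: (h @: D) by rewrite -imset_comp; apply: eq_imset.
have gE : g @: D = snd @: (h @: D) by rewrite -imset_comp; apply: eq_imset.
have fst_inj : {in h @: D &, injective fst}.
  move=> _ _ /imsetP[x xD ->] /imsetP[y yD ->] /= fxy.
  by congr (_, _) => //; apply/eqP; rewrite -fg ?fxy.
have snd_inj : {in h @: D &, injective snd}.
  move=> _ _ /imsetP[x xD ->] /imsetP[y yD ->] /= gxy.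
  by congr (_, _) => //; apply/eqP; rewrite fg ?gxy.
by rewrite fE gE (card_in_imset fst_inj) (card_in_imset snd_inj).
Qed.

(** Counting by fibres. It is applied with [n = 2]: two free flags per half-ribbon and two per
    external face. *)
Lemma card_imset_fiber (f : T -> T') (D : {set T}) n :
  {in D, forall x, #|[set z in D | f z == f x]| = n} -> #|D| = #|f @: D| * n.
Proof.
move=> fn; rewrite -sum1_card (partition_big_imset f) /= -sum_nat_const.
apply: eq_bigr => _ /imsetP[x xD ->]; rewrite -(fn x xD) -sum1_card.
by apply: eq_bigl => z; rewrite inE.
Qed.

End FiniteSets.

Section Components.

Variable T : finType.
Implicit Types (e : rel T) (x y u v : T).

(** Induction along a path extended at its far end; the reachability of [u] stays available in the
    step. *)
Lemma connect_ind_from e (P : T -> Prop) x y :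
  P x -> (forall u v, connect e x u -> P u -> e u v -> P v) ->
  connect e x y -> P y.
Proof.
move=> Px Pstep /connectP[p ep ->]; elim/last_ind: p ep => //= p z IHp.
rewrite rcons_path last_rcons => /andP[ep ez].
by apply: Pstep ez; [apply/connectP; exists p | apply: IHp].
Qed.

Definition component e x : {set T} := [set y in [set: T] | connect e x y].

Lemma componentsE e : components e [set: T] = component e @: [set: T].
Proof. by []. Qed.

Lemma in_component e x y : (y \in component e x) = connect e x y.
Proof. by rewrite !inE. Qed.

Lemma component_eqE e : ssrbool.symmetric e ->
  forall x y, (component e x == component e y) = connect e x y.
Proof.
move=> e_sym x y; apply/eqP/idP => [eq_xy | xy].
  by rewrite -in_component eq_xy in_component.
apply/setP=> z; rewrite !in_component; apply/idP/idP; last exact: connect_trans.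
by apply: connect_trans; rewrite (sym_connect_sym e_sym).
Qed.

Lemma eq_component e e' : connect e =2 connect e' -> component e =1 component e'.
Proof. by move=> ee' x; apply/setP=> y; rewrite !in_component ee'. Qed.

(** Marked components become an image of the marked points, the form to which [card_imset_eq] and
    [card_imset_fiber] apply. *)
Lemma components_meeting e (P : pred T) : ssrbool.symmetric e ->
  [set C in components e [set: T] | [exists x in C, P x]] =
  component e @: [set x | P x].
Proof.
move=> e_sym; apply/setP=> C; rewrite inE componentsE.
apply/andP/imsetP=> [[/imsetP[x _ ->] /exists_inP[y]] | [x]].
  rewrite in_component => xy Py; exists y; rewrite ?inE //.
  by apply/eqP; rewrite component_eqE.
rewrite inE => Px ->; split; first exact: imset_f.
by apply/exists_inP; exists x; rewrite ?in_component.
Qed.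

Definition add_edge e x y : rel T :=
  [rel u v | [|| e u v, (u == x) && (v == y) | (u == y) && (v == x)]].

Lemma add_edge_sym e x y : ssrbool.symmetric e -> ssrbool.symmetric (add_edge e x y).
Proof.
move=> e_sym u v; rewrite /add_edge /= e_sym; congr (_ || _).
by rewrite orbC; congr (_ || _); rewrite andbC.
Qed.

Lemma add_edge_sub e x y : subrel (connect e) (connect (add_edge e x y)).
Proof. by apply: connect_sub => u v uv; apply: connect1; rewrite /add_edge /= uv. Qed.

Lemma add_edge1 e x y : connect (add_edge e x y) x y.
Proof. by apply: connect1; rewrite /add_edge /= !eqxx orbT. Qed.

Lemma connect_eq e e' : (forall x y, e x y -> connect e' x y) ->
  (forall x y, e' x y -> connect e x y) -> connect e =2 connect e'.
Proof. by move=> ee' e'e x y; apply/idP/idP; apply: connect_sub. Qed.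

Lemma card_components_eq e e' : connect e =2 connect e' ->
  #|components e [set: T]| = #|components e' [set: T]|.
Proof. by move=> ee'; rewrite !componentsE (eq_imset _ (eq_component ee')). Qed.

(** A new edge merges two components or changes nothing. When it merges them, the component of [y]
    is discarded: what is left still meets every new component, and on it old and new connectivity
    agree. *)
Lemma card_components_add_edge e x y : ssrbool.symmetric e ->
  #|components (add_edge e x y) [set: T]| + ~~ connect e x y =
  #|components e [set: T]|.
Proof.
move=> e_sym; have csym := sym_connect_sym e_sym.
case: (boolP (connect e x y)) => [xy | nxy] /=.
  rewrite addn0; apply: card_components_eq; apply: connect_eq.
    move=> u v /or3P[/connect1 // | |] /andP[/eqP-> /eqP->] //.
    by rewrite csym.
  by move=> u v uv; apply/add_edge_sub/connect1.
pose D := ~: component e y.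
have xD : x \in D by rewrite inE in_component csym.
(* A path through the new edge starts in the old component of [x] or [y] and ends in one of these
   two. *)
have addE u v : connect (add_edge e x y) u v ->
    connect e u v \/ (connect e u x || connect e u y) && (connect e x v || connect e y v).
  apply: (@connect_ind_from _ (fun v => connect e u v \/
    (connect e u x || connect e u y) && (connect e x v || connect e y v))); first by left.
  move=> a b _ IH /or3P[ab | /andP[/eqP ea /eqP eb] | /andP[/eqP ea /eqP eb]].
  - case: IH => [ua | /andP[-> /orP[] H]]; [left | right..].
    + exact: connect_trans ua (connect1 ab).
    + by rewrite (connect_trans H (connect1 ab)).
    + by rewrite (connect_trans H (connect1 ab)) orbT.
  - right; subst; rewrite connect0 orbT andbT.
    by case: IH => [-> | /andP[]].
  - right; subst; rewrite connect0 /= andbT.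
    by case: IH => [-> | /andP[]]; rewrite ?orbT.
have -> : #|components (add_edge e x y) [set: T]| = #|component e @: D|.
  have -> : components (add_edge e x y) [set: T] = component (add_edge e x y) @: D.
    apply/eqP; rewrite componentsE eqEsubset andbC imsetS ?subsetT //=.
    apply/subsetP=> _ /imsetP[z _ ->].
    have [yz | nyz] := boolP (connect e y z); last first.
      by apply: imset_f; rewrite inE in_component.
    have -> : component (add_edge e x y) z = component (add_edge e x y) x.
      apply/eqP; rewrite component_eqE; last exact: add_edge_sym.
      rewrite (sym_connect_sym (add_edge_sym x y e_sym)).
      exact: connect_trans (add_edge1 _ _ _) (add_edge_sub _ _ yz).
    exact: imset_f.
  apply: card_imset_eq => u v; rewrite !inE /= => nyu nyv.
  rewrite !component_eqE //; last exact: add_edge_sym.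
  apply/idP/idP=> [/addE[] // | ]; last exact: add_edge_sub.
  rewrite [connect e u y]csym (negPf nyu) (negPf nyv) !orbF => /andP[].
  exact: connect_trans.
have -> : components e [set: T] = component e y |: component e @: D.
  rewrite componentsE; apply/eqP; rewrite eqEsubset; apply/andP; split.
    apply/subsetP=> _ /imsetP[z _ ->]; rewrite inE in_set1 component_eqE //.
    have [_ // | nyz] := boolP (connect e z y).
    by rewrite imset_f // inE in_component csym.
  by rewrite subUset sub1set imset_f //= imsetS // subsetT.
rewrite cardsU1 addnC; suff -> : component e y \notin component e @: D by [].
apply/imsetP=> -[z]; rewrite inE in_component => /negP nyz /eqP.
by rewrite component_eqE.
Qed.

End Components.

(** * Orbits of two involutions *)

Section TwoInvolutions.

Variables (T : finType) (f g : T -> T).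
Hypotheses (fK : involutive f) (gK : involutive g).

Definition alternate : rel T := [rel u v | (v == f u) || (v == g u)].

Lemma alternate_sym : ssrbool.symmetric alternate.
Proof.
by move=> u v; rewrite /alternate /= -(inv_eq fK) -(inv_eq gK) ![u == _]eq_sym.
Qed.

Lemma connect_alternate1 x : connect alternate x (f x).
Proof. by apply: connect1; rewrite /alternate /= eqxx. Qed.

Lemma connect_alternate2 x : connect alternate x (g x).
Proof. by apply: connect1; rewrite /alternate /= eqxx orbT. Qed.

(* The component of a fixed point [x] of [f] is the orbit of [x] under the
   rotation [f \o g], in which [f] acts as the reflection
   [i |-> n - i], where [n] is the order of the orbit.  Since [g] has no fixed
   point, [n] is even, and so [f] fixes exactly the indices [0] and [n / 2]. *)
Lemma card_fixpoints_component x : (forall y, g y != y) -> f x = x ->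
  #|[set z | (f z == z) && connect alternate x z]| = 2.
Proof.
move=> g_neq fx; pose h := f \o g.
have h_inj : injective h by apply: inj_comp; apply: inv_inj.
pose n := order h x.
have n_gt0 : 0 < n by apply: order_gt0.
have iter_inj i : injective (iter i h) by elim: i => //= i IH u v /h_inj/IH.
(* The reflection [f] conjugates the rotation [h] to its inverse. *)
have hfh i u : iter i h (f (iter i h u)) = f u.
  elim: i => //= i IH; rewrite -iterS iterSr -[RHS]IH /h /= fK gK.
  by [].
have f_iter i : i <= n -> f (iter i h x) = iter (n - i) h x.
  move=> le_in; apply: (@iter_inj i).
  by rewrite hfh -iterD subnKC // fx iter_order.
have conE z : connect alternate x z = fconnect h x z.
  apply/idP/idP; last first.
    apply: connect_sub => u v /eqP<-.
    exact: connect_trans (connect_alternate2 _) (connect_alternate1 _).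
  apply: (connect_ind_from (P := fun z => fconnect h x z)) => // u v _ xu.
  have [i lt_in ui] : exists2 i, i < n & u = iter i h x.
    by exists (findex h x u); rewrite ?findex_max ?iter_findex.
  case/orP=> /eqP->; rewrite {}ui.
    by rewrite f_iter ?fconnect_iter // ltnW.
  have -> : g (iter i h x) = f (iter i.+1 h x) by rewrite /= fK.
  by rewrite f_iter // fconnect_iter.
have fix_iter i : i < n -> (f (iter i h x) == iter i h x) = (i == 0) || (i.*2 == n).
  case: i => [|i] lt_in; first by rewrite /= fx eqxx.
  rewrite f_iter 1?ltnW //; apply/eqP/idP => [|/= /eqP <-]; last first.
    by rewrite -addnn addnK.
  move/(congr1 (findex h x)); rewrite !findex_iter //; last by lia.
  by lia.
(* If [n = 2m + 1], the reflection sends index [m + 1] to [m]; since [f] also sends the point of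
   index [m + 1] to the image by [g] of the point of index [m], that point would be fixed by [g]. *)
have n_even : n = n./2.*2.
  rewrite -[LHS]odd_double_half; case: (boolP (odd n)) => // n_odd.
  pose m := n./2; have nm : n = m.*2.+1 by rewrite -[LHS]odd_double_half n_odd.
  have le_mn : m.+1 <= n by rewrite nm; lia.
  have := f_iter m.+1 le_mn; rewrite (_ : n - m.+1 = m); last by rewrite nm; lia.
  by rewrite iterS {1}/h /= fK => E; case/negP: (g_neq (iter m h x)); rewrite E.
have half_lt : n./2 < n by lia.
rewrite [[set _ | _]](_ : _ = [set x; iter n./2 h x]).
  rewrite cards2; case: eqP => // /(congr1 (findex h x)).
  by rewrite findex0 findex_iter //; lia.
apply/setP=> z; rewrite !inE conE; apply/andP/orP=> [[fz xz] | [] /eqP->].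
- have lt_zn : findex h x z < n by apply: findex_max.
  have zE := iter_findex xz; move: fz; rewrite -{1 2}zE fix_iter // => /orP[] /eqP zi.
    by left; rewrite -zE zi.
  by right; rewrite -zE; apply/eqP; congr iter; lia.
- by rewrite fx eqxx connect0.
- by rewrite fix_iter // -n_even eqxx orbT fconnect_iter.
Qed.

End TwoInvolutions.

(** * Curves of a state and faces of a c-subgraph *)

Section HalfRibbons.

Variable G : ribbon_graph.
Implicit Types x y z : flag G.

Lemma mem_ribbon x : x \in ribbon x.
Proof. by rewrite !inE eqxx. Qed.

Lemma ribbon_eqE x y : (ribbon x == ribbon y) = (y \in ribbon x).
Proof.
apply/eqP/idP=> [-> | ]; first exact: mem_ribbon.
by rewrite !inE -!orbA => /or4P[] /eqP->; rewrite ?ribbon_along ?ribbon_across.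
Qed.

Lemma along_fix_ribbon x y : y \in ribbon x -> (along y == y) = (along x == x).
Proof.
rewrite !inE -!orbA => /or4P[] /eqP-> //; rewrite ?alongK ?along_acrossC ?alongK.
- exact: eq_sym.
- by rewrite (inj_eq (inv_inj (@acrossK G))).
- by rewrite (inj_eq (inv_inj (@acrossK G))) eq_sym.
Qed.

Lemma ribbon_fix x : along x = x -> ribbon x = [set x; across x].
Proof.
move=> fx; apply/setP=> y; rewrite !inE along_acrossC fx.
by do 2!case: (y == _).
Qed.

Definition free_flags : {set flag G} := [set x | along x == x].

Lemma half_ribbonsE : half_ribbons G = @ribbon G @: free_flags.
Proof.
apply/setP=> h; apply/imsetP/imsetP=> -[x];
  by rewrite ?inE => fx ->; exists x; rewrite ?inE.
Qed.

Lemma card_free_flags : #|free_flags| = nhalf_ribbons G * 2.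
Proof.
rewrite /nhalf_ribbons half_ribbonsE; apply: card_imset_fiber => x.
rewrite inE => /eqP fx.
rewrite [[set _ in _ | _]](_ : _ = [set x; across x]).
  by rewrite cards2 eq_sym across_neq.
apply/setP=> z; rewrite -ribbon_fix // 2!in_set.
rewrite [ribbon z == _]eq_sym ribbon_eqE.
case: (boolP (z \in ribbon x)) => [zx | _]; last exact: andbF.
by rewrite (along_fix_ribbon zx) fx eqxx.
Qed.

Lemma external_facesE :
  external_faces G = component (alternate (@along G) (@around G)) @: free_flags.
Proof.
by apply: components_meeting; apply: alternate_sym; [exact: alongK | exact: aroundK].
Qed.

(** Double counting of the free flags: each half-ribbon has two, and each external face has two by
    [card_fixpoints_component]. *)
Lemma card_external_faces : #|external_faces G| = nhalf_ribbons G.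
Proof.
suff: #|free_flags| = #|external_faces G| * 2 by rewrite card_free_flags; lia.
rewrite external_facesE; apply: card_imset_fiber => x; rewrite inE => /eqP fx.
have cp := card_fixpoints_component (@alongK G) (@aroundK G) (@around_neq G) fx.
rewrite -{}[RHS]cp; apply: eq_card => z; rewrite !inE; congr (_ && _).
rewrite eq_sym component_eqE //.
by apply: alternate_sym; [exact: alongK | exact: aroundK].
Qed.

(** Boundary pieces continued across the free ends of half-ribbons. It lives on flags, so that
    boundary graph components and punctured curves can both be compared with it. *)
Definition free_glue : rel (flag G) :=
  [rel x y | alternate (@along G) (@around G) x y || (along x == x) && (y == across x)].

Lemma free_glue_sym : ssrbool.symmetric free_glue.
Proof.
move=> x y; rewrite /free_glue /=.
rewrite alternate_sym; [| exact: alongK | exact: aroundK].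
congr (_ || _); have [-> | yx] := eqVneq y (across x).
  by rewrite acrossK eqxx along_acrossC (inj_eq (inv_inj (@acrossK G))).
rewrite andbF; apply/esym/negP=> /andP[_ /eqP xy].
by rewrite xy acrossK eqxx in yx.
Qed.

Lemma boundary_adjacent_sym : ssrbool.symmetric (@boundary_adjacent G).
Proof.
move=> h k; rewrite /boundary_adjacent /= andbCA; congr [&& _, _ & _].
by apply: eq_existsb => C; rewrite [(h :&: C != _) && _]andbC.
Qed.

Lemma boundary_adjacent_face x y :
  along x = x -> along y = y -> connect (alternate (@along G) (@around G)) x y ->
  boundary_adjacent (ribbon x) (ribbon y).
Proof.
move=> fx fy xy; rewrite /boundary_adjacent /= half_ribbonsE !imset_f ?inE ?fx ?fy //=.
apply/exists_inP; exists (component (alternate (@along G) (@around G)) x).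
  by rewrite external_facesE imset_f // inE fx.
apply/andP; split; apply/set0Pn; [exists x | exists y].
  by rewrite inE mem_ribbon in_component connect0.
by rewrite inE mem_ribbon in_component.
Qed.

Lemma connect_boundary_adjacent x y : along x = x -> along y = y ->
  connect (@boundary_adjacent G) (ribbon x) (ribbon y) = connect free_glue x y.
Proof.
move=> fx fy; have csym := sym_connect_sym free_glue_sym.
have asym := sym_connect_sym (alternate_sym (@alongK G) (@aroundK G)).
have sub_glue : subrel (connect (alternate (@along G) (@around G))) (connect free_glue).
  by apply: connect_sub => u v uv; apply: connect1; rewrite /free_glue /= uv.
have glue_ribbon u v : along u = u -> v \in ribbon u -> connect free_glue u v.
  move=> fu; rewrite ribbon_fix // !inE => /orP[] /eqP-> //.
  by apply: connect1; rewrite /free_glue /= fu !eqxx orbT.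
apply/idP/idP.
  (* The invariant covers every flag of the half-ribbon reached, since the next face may leave from
     either external point. *)
  move=> xy; suff: forall z, z \in ribbon y -> connect free_glue x z.
    by apply; exact: mem_ribbon.
  apply: (connect_ind_from (P := fun h : {set flag G} =>
    forall z, z \in h -> connect free_glue x z)) xy; first by move=> z; exact: glue_ribbon.
  move=> h k _ xh; rewrite /boundary_adjacent /= half_ribbonsE.
  case/and3P=> /imsetP[u uF hE] /imsetP[v vF kE] /exists_inP[C].
  rewrite external_facesE => /imsetP[c _ ->] /andP[/set0Pn[p] /[!inE]/andP[ph cp]].
  case/set0Pn=> q /[!inE]/andP[qk cq] z zk.
  apply: connect_trans (xh p ph) _.
  apply: (@connect_trans _ _ q).
    by apply: sub_glue; apply: connect_trans cq; rewrite asym.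
  rewrite inE in vF; move/eqP in vF; rewrite kE in qk zk.
  by apply: (@connect_trans _ _ v); [rewrite csym|]; apply: glue_ribbon.
move=> xy.
(* A path of [free_glue] passes through flags that are not free, so the invariant speaks of all free
   flags on the boundary piece of the current flag. *)
suff: forall z, along z = z -> connect (alternate (@along G) (@around G)) y z ->
    connect (@boundary_adjacent G) (ribbon x) (ribbon z) by apply.
apply: (connect_ind_from (P := fun y => forall z, along z = z ->
    connect (alternate (@along G) (@around G)) y z ->
    connect (@boundary_adjacent G) (ribbon x) (ribbon z))) xy.
  by move=> z fz xz; apply: connect1; apply: boundary_adjacent_face.
move=> u v _ IH /orP[uv | /andP[/eqP fu /eqP->]] z fz vz.
  by apply: IH => //; apply: connect_trans (connect1 uv) vz.
apply: connect_trans (IH u fu (connect0 _ _)) _; rewrite -ribbon_across.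
by apply: connect1; apply: boundary_adjacent_face; rewrite // along_acrossC fu.
Qed.

Lemma nboundary_compE : nboundary_comp G = #|component free_glue @: free_flags|.
Proof.
rewrite /nboundary_comp.
have -> : components (@boundary_adjacent G) (half_ribbons G) =
    [set [set k in half_ribbons G | connect (@boundary_adjacent G) (ribbon x) k]
       | x in free_flags].
  rewrite [LHS]/components /equivalence_partition [in LHS]half_ribbonsE -imset_comp.
  by rewrite half_ribbonsE.
apply: card_imset_eq => x y; rewrite !inE => /eqP fx /eqP fy.
rewrite component_eqE; last exact: free_glue_sym.
rewrite -connect_boundary_adjacent //.
have csym := sym_connect_sym boundary_adjacent_sym.
apply/eqP/idP => [/setP/(_ (ribbon y)) | xy].
  by rewrite !inE connect0 half_ribbonsE imset_f ?inE ?fy //= => ->.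
apply/setP=> k; rewrite !inE; congr (_ && _).
by apply/idP/idP; apply: connect_trans; rewrite // csym.
Qed.

End HalfRibbons.

Section Cut.

Variable G : ribbon_graph.
Implicit Types (x y : flag G) (B : {set edge G}).

Lemma is_edge_ribbon x : is_edge (ribbon x) = (along x != x).
Proof.
apply/existsP/idP=> [[y /andP[fy]] | fx]; last by exists x; rewrite fx eqxx.
by rewrite ribbon_eqE => /along_fix_ribbon <-.
Qed.

(** Both sides say that [x] lies on an edge left uncut: half-ribbon flags have no medial vertex and
    are fixed by [along]. *)
Lemma joined_cut B x : joined (M := medial G) (~: B) x = (@along (cut B) x != x).
Proof.
rewrite /joined /= /cut_along /is_cut /edge_at.
case: insubP => [e xe _ | ].
  by rewrite inE; case: (e \in B); rewrite /= ?eqxx // -is_edge_ribbon.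
by rewrite is_edge_ribbon negbK => /eqP->; rewrite eqxx.
Qed.

Lemma nfree_cut B x : ~~ joined (M := medial G) (~: B) x = (@along (cut B) x == x).
Proof. by rewrite joined_cut negbK. Qed.

Lemma state_relE B x y : state_rel (M := medial G) (~: B) x y =
  (y == around x) || (@along (cut B) x != x) && (y == along x).
Proof. by rewrite -joined_cut. Qed.

(** The two relations differ only by loops at the flags fixed by [along] in [cut B], which do not
    affect connectivity. *)
Lemma connect_state_rel B :
  connect (state_rel (M := medial G) (~: B)) =2
  connect (alternate (@along (cut B)) (@around (cut B))).
Proof.
apply: connect_eq => x y.
  rewrite state_relE => /orP[/eqP-> | /andP[xc /eqP->]]; first exact: connect_alternate2.
  have <- : cut_along B x = along x.
    by move: xc; rewrite /= /cut_along; case: ifP => //; rewrite eqxx.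
  exact: connect_alternate1.
case/orP=> /eqP-> /=; last by apply: connect1; rewrite state_relE eqxx.
have [-> // | xc] := eqVneq (cut_along B x) x.
apply: connect1; rewrite state_relE /= xc; apply/orP; right.
by move: xc; rewrite /cut_along; case: ifP => //; rewrite eqxx.
Qed.

Lemma state_curvesE B :
  state_curves (M := medial G) (~: B) = boundary_pieces (cut B).
Proof.
rewrite /state_curves /boundary_pieces !componentsE; apply: eq_imset.
exact: eq_component (connect_state_rel B).
Qed.

Lemma open_curvesE B :
  open_curves (M := medial G) (~: B) = external_faces (cut B).
Proof.
apply/setP=> C; rewrite !inE state_curvesE; congr (_ && _).
by apply: eq_existsb => x; rewrite nfree_cut.
Qed.

Lemma nclosed_cut B : nclosed (M := medial G) (~: B) = nint_faces (cut B).
Proof. by rewrite /nclosed state_curvesE open_curvesE. Qed.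

Lemma nopen_cut B : nopen (M := medial G) (~: B) = nhalf_ribbons (cut B).
Proof. by rewrite -card_external_faces /nopen open_curvesE. Qed.

(** In [medial G] the black arcs and the fictitious vertices both pair flags by [across], so
    reinserting the fictitious vertices amounts to [free_glue] on [cut B]. *)
Lemma npunctured_cut B : npunctured (M := medial G) (~: B) = nboundary_comp (cut B).
Proof.
have con : connect (punctured_rel (M := medial G) (~: B)) =2 connect (@free_glue (cut B)).
  have glueE x : glue (M := medial G) x = across x by rewrite /glue; case: mvertex_at.
  have puncturedE x y : punctured_rel (M := medial G) (~: B) x y =
      state_rel (M := medial G) (~: B) x y ||
      (@along (cut B) x == x) && (y == across x).
    by rewrite -nfree_cut -glueE.
  have sub_free : subrel (connect (alternate (@along (cut B)) (@around (cut B))))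
      (connect (@free_glue (cut B))).
    by apply: connect_sub => u v uv; apply: connect1; rewrite /free_glue /= uv.
  have sub_punctured : subrel (connect (state_rel (M := medial G) (~: B)))
      (connect (punctured_rel (M := medial G) (~: B))).
    by apply: connect_sub => u v uv; apply: connect1; rewrite puncturedE uv.
  apply: connect_eq => x y.
    rewrite puncturedE => /orP[xy | fx].
      by apply: sub_free; rewrite -connect_state_rel; exact: connect1.
    by apply: connect1; rewrite /free_glue /= [X in _ || X]fx orbT.
  case/orP=> [xy | fx]; last by apply: connect1; rewrite puncturedE fx orbT.
  by apply: sub_punctured; rewrite connect_state_rel; exact: connect1.
rewrite nboundary_compE /npunctured.
pose P := [pred x : flag (cut B) | @along (cut B) x == x].
transitivity #|[set C in components (@free_glue (cut B)) [set: flag (cut B)] |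
    [exists x in C, P x]]|; last first.
  by rewrite components_meeting //; exact: free_glue_sym.
apply: eq_card => C; rewrite !inE; congr (_ && _).
  by rewrite !componentsE (eq_imset _ (eq_component con)).
by apply: eq_existsb => x; rewrite nfree_cut.
Qed.

End Cut.

(** * Nonnegativity of the Euler genus *)

(** Saturation under [e'] maps the components of [e] onto those of [e']. *)
Lemma leq_card_components (T : finType) (e e' : rel T) :
  ssrbool.symmetric e' -> subrel (connect e) (connect e') ->
  #|components e' [set: T]| <= #|components e [set: T]|.
Proof.
move=> e'_sym ee'; have csym := sym_connect_sym e'_sym.
pose h (C : {set T}) := [set y | [exists x in C, connect e' x y]].
rewrite !componentsE; suff -> : component e' @: setT = h @: (component e @: setT).
  exact: leq_imset_card.
rewrite -imset_comp; apply: eq_imset => x; apply/setP=> y /=.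
rewrite in_component inE; apply/idP/exists_inP=> [xy | [z]].
  by exists x; rewrite ?in_component ?connect0.
by rewrite in_component => /ee' xz zy; exact: connect_trans xz zy.
Qed.

Section Capped.

Variable G : ribbon_graph.
Implicit Types x y : flag G.

Lemma at_vertex_across x : at_vertex (across x) = at_vertex x.
Proof.
by apply/esym/eqP; rewrite at_vertexP; exact: (connect_alternate1 (@across G) (@around G)).
Qed.

Lemma at_vertex_around x : at_vertex (around x) = at_vertex x.
Proof.
by apply/esym/eqP; rewrite at_vertexP; exact: (connect_alternate2 (@across G) (@around G)).
Qed.

Lemma adjacent_sym : ssrbool.symmetric (@adjacent G).
Proof.
move=> u v; apply/existsP/existsP=> -[x /andP[/eqP<- /eqP<-]];
  by exists (along x); rewrite alongK !eqxx.
Qed.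

Lemma adjacent_along x : adjacent (at_vertex x) (at_vertex (along x)).
Proof. by apply/existsP; exists x; rewrite !eqxx. Qed.

Lemma leq_ncomp_vertex : ncomp G <= #|vertex G|.
Proof. by rewrite -cardsT; exact: leq_imset_card. Qed.

(* Follows the boundary of the surface with all half-ribbons removed. *)
Definition cap x := if along x == x then across x else along x.

Lemma capK : involutive cap.
Proof.
move=> x; rewrite /cap; case: (eqVneq (along x) x) => [fx | nfx].
  by rewrite along_acrossC fx eqxx acrossK.
by rewrite alongK eq_sym (negPf nfx).
Qed.

Lemma cap_neq x : cap x != x.
Proof. by rewrite /cap; case: ifP => [_|->] //; exact: across_neq. Qed.

Lemma at_vertex_cap x : connect (@adjacent G) (at_vertex x) (at_vertex (cap x)).
Proof.
rewrite /cap; case: ifP => _; first by rewrite at_vertex_across.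
exact/connect1/adjacent_along.
Qed.

Definition capped_rel : rel (flag G) := alternate cap (@around G).

Lemma capped_rel_sym : ssrbool.symmetric capped_rel.
Proof. by apply: alternate_sym; [exact: capK | exact: aroundK]. Qed.

Lemma connect_cap_vertex x y : connect capped_rel x y ->
  connect (@adjacent G) (at_vertex x) (at_vertex y).
Proof.
apply: (connect_ind_from (P := fun y =>
  connect (@adjacent G) (at_vertex x) (at_vertex y))) => // u v _ xu /orP[] /eqP->.
  exact: connect_trans xu (at_vertex_cap u).
by rewrite at_vertex_around.
Qed.

(** Boundary circles of the surface without its half-ribbons;
    [#|vertex G| - #|edge G| + ncapped_faces] is the Euler characteristic of the closed surface
    obtained by gluing discs to them. *)
Definition ncapped_faces : nat :=
  #|components capped_rel [set: flag G]| + #|isolated G|.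

(** An internal face has no free flag, so [cap] and [along] agree on it and it is also a capped
    face. *)
Lemma leq_nint_capped : nint_faces G <= ncapped_faces.
Proof.
rewrite /nint_faces leq_add2r; apply/subset_leq_card/subsetP=> C.
rewrite inE inE => /andP[]; rewrite {2}/boundary_pieces componentsE.
move=> /[swap] /imsetP[x _ CE].
have -> : C \in boundary_pieces G by rewrite CE /boundary_pieces componentsE imset_f.
rewrite /= => /exists_inPn noFix; rewrite componentsE; apply/imsetP; exists x => //.
have nfix u : connect (alternate (@along G) (@around G)) x u -> along u != u.
  by move=> xu; apply: noFix; rewrite CE in_component.
rewrite CE; apply/setP=> y; rewrite !in_component; apply/idP/idP.
  apply: (connect_ind_from (P := fun y => connect capped_rel x y)) => //.
  move=> u v /nfix fu xu /orP[] /eqP->; apply: connect_trans xu _.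
    have <- : cap u = along u by rewrite /cap (negPf fu).
    exact: connect_alternate1.
  exact: connect_alternate2.
apply: (connect_ind_from (P := fun y => connect (alternate (@along G) (@around G)) x y)) => //.
move=> u v _ xu /orP[] /eqP->; last exact: connect_trans xu (connect_alternate2 _ _ _).
rewrite /cap (negPf (nfix u xu)); exact: connect_trans xu (connect_alternate1 _ _ _).
Qed.

Lemma card_image_at_vertex : #|codom (@at_vertex G)| + #|isolated G| = #|vertex G|.
Proof.
rewrite -(cardsC [set v | v \in codom (@at_vertex G)]) cardsE.
by congr (_ + _); apply: eq_card => v; rewrite !inE.
Qed.

(** Here [cap] is [across], so by [at_vertexP] the capped circles are the boundaries of the vertex
    discs. *)
Lemma edgeless_capped : (forall x, along x = x) -> ncapped_faces = #|vertex G|.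
Proof.
move=> fx; rewrite -card_image_at_vertex /ncapped_faces; congr (_ + _).
have -> : #|codom (@at_vertex G)| = #|@at_vertex G @: [set: flag G]|.
  by apply: eq_card => v; apply/codomP/imsetP=> [[x ->] | [x _ ->]]; exists x.
rewrite componentsE; apply: card_imset_eq => x y _ _.
rewrite component_eqE; last exact: capped_rel_sym.
rewrite at_vertexP; apply: eq_connect => u v.
by rewrite /capped_rel /alternate /= /cap fx eqxx.
Qed.

Lemma edgeless_ncomp : (forall x, along x = x) -> ncomp G = #|vertex G|.
Proof.
move=> fx; rewrite /ncomp componentsE card_in_imset ?cardsT // => u v _ _ /eqP.
rewrite component_eqE; last exact: adjacent_sym.
apply: (connect_ind_from (P := fun v => u = v)) => // {}v w _ -> /existsP[x].
by rewrite fx => /andP[/eqP-> /eqP].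
Qed.

End Capped.

(** * Effect of cutting one edge on components and faces *)

Section CutEdge.

Variable G : ribbon_graph.
Implicit Types (x y z : flag G) (B : {set edge G}) (e : edge G).

Lemma edge_atP x e : (edge_at x == Some e) = (ribbon x == val e).
Proof.
rewrite /edge_at; case: insubP => [e' _ <- | nx]; first exact: val_eqE.
by apply/esym; apply: contraNF nx => /eqP->; exact: valP e.
Qed.

Lemma edge_flag e : exists x, along x != x /\ ribbon x = val e.
Proof. by have /existsP[x /andP[fx /eqP re]] := valP e; exists x. Qed.

Lemma is_cutE B x e : ribbon x = val e -> is_cut B x = (e \in B).
Proof.
move=> xe; rewrite /is_cut.
by have /eqP-> : edge_at x == Some e by rewrite edge_atP xe.
Qed.

Lemma card_edge_cut B : #|edge (cut B)| = #|~: B|.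
Proof.
rewrite card_sig -[RHS](card_imset _ val_inj); apply: eq_card => r; rewrite !inE /=.
apply/existsP/imsetP=> [[x /andP[]] | [e eB ->]].
  rewrite /ribbon /= /cut_along; case: ifP => [_ | xB fx /eqP->]; first by rewrite eqxx.
  have xe : is_edge (@ribbon G x) by rewrite is_edge_ribbon.
  exists (Sub (@ribbon G x) xe); last by rewrite SubK is_cut_across xB.
  by rewrite inE -(is_cutE B (x := x) (e := Sub (@ribbon G x) xe)) // xB.
have [x [fx xe]] := edge_flag e; exists x; rewrite inE in eB.
by rewrite /ribbon /= /cut_along is_cut_across (is_cutE B xe) (negPf eB) fx -xe eqxx.
Qed.

Lemma leq_ncomp_cut B : ncomp G <= ncomp (cut B).
Proof.
apply: leq_card_components; first exact: adjacent_sym.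
apply: connect_sub => u v /existsP[x /andP[/eqP<- /eqP<-]] /=.
rewrite /cut_along; case: ifP => // _; exact/connect1/adjacent_along.
Qed.

Section Step.

Variables (B : {set edge G}) (e : edge G) (x : flag G).
Hypotheses (eB : e \notin B) (fx : along x != x) (xe : ribbon x = val e).

Let A := cut B.
Let A' := cut (e |: B).

Lemma cut_along_in y : y \in ribbon x -> @along A y = along y.
Proof.
rewrite -ribbon_eqE => /eqP xy.
by rewrite /= /cut_along (is_cutE B (e := e)) -?xy // (negPf eB).
Qed.

Lemma cut_along_step y :
  @along A' y = if y \in ribbon x then y else @along A y.
Proof.
rewrite -ribbon_eqE /= /cut_along /is_cut xe eq_sym -edge_atP.
case: edge_at => [e'|] //=; rewrite (inj_eq Some_inj) in_setU1.
by case: eqP.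
Qed.

Lemma cap_out y : y \notin ribbon x -> @cap A' y = @cap A y.
Proof. by move=> xy; rewrite /cap cut_along_step (negPf xy). Qed.

Lemma cap_in y : y \in ribbon x -> @cap A y = along y.
Proof.
by move=> xy; rewrite /cap cut_along_in // (along_fix_ribbon xy) (negPf fx).
Qed.

Lemma cap_in' y : y \in ribbon x -> @cap A' y = across y.
Proof. by move=> xy; rewrite /cap cut_along_step xy eqxx. Qed.

Let bridge := ~~ connect (@adjacent A') (at_vertex x) (at_vertex (along x)).

Lemma ncomp_step : ncomp A + bridge = ncomp A'.
Proof.
rewrite /ncomp -(card_components_add_edge (at_vertex x : vertex A')
  (at_vertex (along x)) (@adjacent_sym A')).
congr (_ + _); apply: card_components_eq; apply: connect_eq => u v.
  case/existsP=> y /andP[/eqP<- /eqP<-].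
  have [xy | xy] := boolP (y \in ribbon x).
    rewrite cut_along_in //.
    have csym := sym_connect_sym (add_edge_sym (at_vertex x : vertex A')
      (at_vertex (along x)) (@adjacent_sym A')).
    have xx := add_edge1 (@adjacent A') (at_vertex x) (at_vertex (along x)).
    move: xy; rewrite !inE -!orbA => /or4P[] /eqP->;
      by rewrite ?along_acrossC ?at_vertex_across ?alongK //; rewrite csym.
  apply/add_edge_sub/connect1/existsP; exists y.
  by rewrite cut_along_step (negPf xy) !eqxx.
have xadj : connect (@adjacent A) (at_vertex x) (at_vertex (along x)).
  apply: connect1; apply/existsP; exists x.
  by rewrite [@along A x]cut_along_in ?mem_ribbon // !eqxx.
case/or3P=> [/existsP[y /andP[/eqP<- /eqP<-]] | |] /=.
- have := cut_along_step y; rewrite /= => ->; case: ifP => // _.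
  by apply: connect1; apply/existsP; exists y; rewrite !eqxx.
- by case/andP=> /eqP-> /eqP->.
- by case/andP=> /eqP-> /eqP->; rewrite (sym_connect_sym (@adjacent_sym A)).
Qed.

Lemma in_ribbon_along y : y \in ribbon x -> along y \in ribbon x.
Proof. by rewrite -!ribbon_eqE ribbon_along. Qed.

Lemma in_ribbon_across y : y \in ribbon x -> across y \in ribbon x.
Proof. by rewrite -!ribbon_eqE ribbon_across. Qed.

(* Both graphs become the same one after joining the two circles at both ends of
   the edge, respectively on both sides of the edge. *)
Lemma connect_capped_step :
  connect (add_edge (@capped_rel A) x (across x)) =2
  connect (add_edge (@capped_rel A') x (along x)).
Proof.
have s := sym_connect_sym (add_edge_sym x (across x) (@capped_rel_sym A)).
have s' := sym_connect_sym (add_edge_sym x (along x) (@capped_rel_sym A')).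
have xx := add_edge1 (@capped_rel A) x (across x).
have xx' := add_edge1 (@capped_rel A') x (along x).
have toA u v : @capped_rel A u v -> connect (add_edge (@capped_rel A) x (across x)) u v.
  by move=> uv; apply/add_edge_sub/connect1.
have toA' u v : @capped_rel A' u v -> connect (add_edge (@capped_rel A') x (along x)) u v.
  by move=> uv; apply/add_edge_sub/connect1.
have along1 y : y \in ribbon x -> connect (add_edge (@capped_rel A) x (across x)) y (along y).
  by move=> xy; rewrite -cap_in //; apply: toA; rewrite /capped_rel /alternate /= eqxx.
have across1 y : y \in ribbon x -> connect (add_edge (@capped_rel A') x (along x)) y (across y).
  by move=> xy; rewrite -cap_in' //; apply: toA'; rewrite /capped_rel /alternate /= eqxx.
have x_in := mem_ribbon x.
have inA y : y \in ribbon x -> connect (add_edge (@capped_rel A) x (across x)) x y.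
  rewrite !inE -!orbA => /or4P[] /eqP-> //; first exact: along1.
  by apply: connect_trans xx _; apply: along1; exact: in_ribbon_across.
have inA' y : y \in ribbon x -> connect (add_edge (@capped_rel A') x (along x)) x y.
  rewrite !inE -!orbA => /or4P[] /eqP-> //; first exact: across1.
  rewrite along_acrossC.
  by apply: connect_trans xx' _; apply: across1; exact: in_ribbon_along.
apply: connect_eq => u v /or3P[/orP[/eqP-> | uv] | |].
- have [xu | xu] := boolP (u \in ribbon x).
    rewrite cap_in //; apply: (@connect_trans _ _ x); first by rewrite s' inA'.
    by rewrite inA' // in_ribbon_along.
  by rewrite -cap_out //; apply: toA'; rewrite /capped_rel /alternate /= eqxx.
- by apply: toA'; rewrite /capped_rel /alternate /= [X in _ || X]uv orbT.
- by case/andP=> /eqP-> /eqP->; exact: across1.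
- by case/andP=> /eqP-> /eqP->; rewrite s'; exact: across1.
- have [xu | xu] := boolP (u \in ribbon x).
    rewrite cap_in' //; apply: (@connect_trans _ _ x); first by rewrite s inA.
    by rewrite inA // in_ribbon_across.
  by rewrite cap_out //; apply: toA; rewrite /capped_rel /alternate /= eqxx.
- by apply: toA; rewrite /capped_rel /alternate /= [X in _ || X]uv orbT.
- by case/andP=> /eqP-> /eqP->; exact: along1.
- by case/andP=> /eqP-> /eqP->; rewrite s; exact: along1.
Qed.

(* Without its two sides, a bridge leaves the corners at one of its ends joined
   to each other, by the parity of the ends of a path. *)
Lemma bridge_across : bridge -> connect (@capped_rel A) x (across x).
Proof.
(* The involution [cap0] is [cap] with both sides of the edge erased; its fixed points are exactly
   the four flags of the edge. *)
move=> br; pose cap0 y := if y \in ribbon x then y else @cap A y.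
have cap0_in y : y \notin ribbon x -> @cap A y \notin ribbon x.
  move=> xy; apply: contra xy => /[dup] /cap_in yE /in_ribbon_along.
  by rewrite -yE capK.
have cap0K : involutive cap0.
  move=> y; rewrite /cap0; have [xy | xy] := boolP (y \in ribbon x); first by rewrite xy.
  by rewrite (negPf (cap0_in y xy)) capK.
have x_fix : cap0 x = x by rewrite /cap0 mem_ribbon.
have := card_fixpoints_component cap0K (@aroundK A) (@around_neq A) x_fix.
set F := [set z | _] => F2.
have /set0Pn[z] : F :\ x != set0.
  have := cardsD1 x F; rewrite F2 inE x_fix eqxx connect0 /= => -[] F1.
  by rewrite -card_gt0; lia.
rewrite !inE => /andP[zx /andP[fz xz]].
have z_in : z \in ribbon x.
  by move: fz; rewrite /cap0; case: ifP => // _; rewrite (negPf (@cap_neq A _)).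
have subA : subrel (connect (alternate cap0 (@around A))) (connect (@capped_rel A)).
  apply: connect_sub => u v /orP[] /eqP->; last exact: connect_alternate2.
  by rewrite /cap0; case: ifP => // _; exact: connect_alternate1.
have subA' : subrel (connect (alternate cap0 (@around A))) (connect (@capped_rel A')).
  apply: connect_sub => u v /orP[] /eqP->; last exact: connect_alternate2.
  rewrite /cap0; case: ifP => // /negbT xu; rewrite -cap_out //; exact: connect_alternate1.
have := connect_cap_vertex (subA' _ _ xz) => /= xz'.
(* The second end [z] of the path lies in the component of [x] in [A'], so it cannot be at the other
   end of the bridge; only [across x] remains. *)
move: z_in zx xz xz'; rewrite !inE -!orbA => /or4P[] /eqP->.
- by rewrite eqxx.
- by move=> _ _ xz'; rewrite /bridge xz' in br.
- by move=> _ xz _; exact: subA.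
- by rewrite along_acrossC at_vertex_across => _ _ xz'; rewrite /bridge xz' in br.
Qed.

(** Both counts are compared with that of the common graph of [connect_capped_step], which each
    exceeds by at most one. For a bridge, [A] has the common count and [A'] one more. *)
Lemma ncapped_step : ncapped_faces A + bridge.*2 <= ncapped_faces A' + 1.
Proof.
rewrite /ncapped_faces.
have EA := card_components_add_edge x (across x) (@capped_rel_sym A).
have EA' := card_components_add_edge x (along x) (@capped_rel_sym A').
have iso : #|isolated A| = #|isolated A'| by [].
have := card_components_eq connect_capped_step.
rewrite iso -EA -EA' => ->; rewrite -!addnA leq_add2l.
have [br | _] := boolP bridge; last by do 2!case: connect; lia.
rewrite bridge_across //.
have -> : connect (@capped_rel A') x (along x) = false.
  by apply: contraNF br; exact: connect_cap_vertex.
lia.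
Qed.

End Step.

(** Both bounds are equalities when all edges are cut. Restoring an edge adds one edge, lowers the
    number of components by one for a bridge and not otherwise, and adds at most one face, or
    removes one for a bridge. *)
Lemma Euler_cut B :
  #|vertex G| <= ncomp (cut B) + #|~: B| /\
  ncapped_faces (cut B) + #|vertex G| <= (ncomp (cut B)).*2 + #|~: B|.
Proof.
have [n] := ubnP #|~: B|; elim: n B => // n IH B; rewrite ltnS => le_n.
have [B0 | [e eB]] := set_0Vmem (~: B).
  have fx x : @along (cut B) x = x.
    rewrite /= /cut_along /is_cut /edge_at; case: insubP => [e _ _ | ].
      by have := in_set0 e; rewrite -B0 inE => /negbFE->.
    by rewrite is_edge_ribbon negbK => /eqP.
  by rewrite (@edgeless_capped (cut B) fx) (@edgeless_ncomp (cut B) fx) B0 cards0 /=; split; lia.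
rewrite inE in eB; have [x [fx xe]] := edge_flag e.
have cE : #|~: B| = #|~: (e |: B)|.+1.
  by rewrite (cardsD1 e) inE eB; congr (_ + #|pred_of_set _|); rewrite setCU setIC -setDE.
have [|IH1 IH2] := IH (e |: B); first by rewrite -cE in le_n *; lia.
have s1 := ncomp_step eB xe; have s2 := ncapped_step eB fx xe.
by move: IH1 IH2 s1 s2; rewrite cE; case: connect => /=; lia.
Qed.

End CutEdge.

(** * Comparison of exponents *)

Section Exponents.

Variable G : ribbon_graph.
Implicit Type B : {set edge G}.

(** The records [cut set0] and [G] have the same adjacency; this transfers [Euler_cut] to [G]
    itself. *)
Lemma ncomp_cut0 : ncomp (cut (set0 : {set edge G})) = ncomp G.
Proof.
apply: card_components_eq; apply: eq_connect => u v.
apply: eq_existsb => x; rewrite /= /cut_along /is_cut.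
by case: edge_at => [e|] //; rewrite in_set0.
Qed.

Lemma rank_leq_edges : rank G <= #|edge G|.
Proof.
have [+ _] := Euler_cut (set0 : {set edge G}).
by rewrite ncomp_cut0 setC0 cardsT /rank => ?; lia.
Qed.

Lemma edges_cut B : rank (cut B) + nullity (cut B) = #|~: B|.
Proof.
have [+ _] := Euler_cut B.
by rewrite /nullity card_edge_cut /rank => ?; rewrite subnKC //= leq_subLR.
Qed.

Lemma rank_cut B : rank (cut B) <= rank G.
Proof. exact: leq_sub2l (leq_ncomp_cut B). Qed.

(** By [Euler_cut], internal faces number at most [2k + E - V], which is [k + n] because [E = r + n]
    and [r = V - k]. *)
Lemma nint_faces_cut B : nint_faces (cut B) <= ncomp (cut B) + nullity (cut B).
Proof.
have [EV EF] := Euler_cut B; have le_V := leq_ncomp_vertex (cut B).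
have le_F := leq_nint_capped (cut B).
have := edges_cut B; rewrite /rank => EE.
by move: EV EF le_V le_F EE; rewrite /=; lia.
Qed.

End Exponents.

Local Open Scope ring_scope.

(** * Evaluation of the polynomial in the target ring *)

Section Evaluation.

Variables (R : comNzRingType) (x y z s w t : R).
Local Notation ev := (Reval x y z s w t).

Lemma Reval_sum (I : finType) (F : I -> Rring) : ev (\sum_i F i) = \sum_i ev (F i).
Proof.
apply: (big_morph ev) => [P Q|]; rewrite /Reval /= ?rmorphD ?hornerD //.
by rewrite rmorph0 horner0.
Qed.

(** Since [W2W] has degree 2, a constant is its own reduced representative. *)
Lemma Reval_const p :
  ev (Rconst p) = mmap intr (fun i : 'I_5 => [:: x; y; z; s; t]`_i) p.
Proof.
rewrite /Reval /Rconst in_qpoly_small ?map_polyC ?hornerC //.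
rewrite mk_monic_W2W /W2W size_polyDl ?size_polyXn ?size_polyN ?size_polyX //.
by rewrite size_polyC; case: eqP.
Qed.

Lemma Reval_varW : ev varW = w.
Proof.
rewrite /Reval /varW in_qpoly_small ?map_polyX ?hornerX //.
by rewrite mk_monic_W2W /W2W size_polyDl ?size_polyXn ?size_polyN ?size_polyX.
Qed.

Lemma Reval_varX : ev varX = x.
Proof. by rewrite Reval_const mmapX mmap1U inordK. Qed.
Lemma Reval_varY : ev varY = y.
Proof. by rewrite Reval_const mmapX mmap1U inordK. Qed.
Lemma Reval_varZ : ev varZ = z.
Proof. by rewrite Reval_const mmapX mmap1U inordK. Qed.
Lemma Reval_varS : ev varS = s.
Proof. by rewrite Reval_const mmapX mmap1U inordK. Qed.
Lemma Reval_varT : ev varT = t.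
Proof. by rewrite Reval_const mmapX mmap1U inordK. Qed.

Hypothesis w_idem : w ^+ 2 = w.

Lemma RevalM P Q : ev (P * Q) = ev P * ev Q.
Proof. exact: (Reval_is_monoid_morphism x y z s t w_idem).2. Qed.

Lemma Reval1 : ev 1 = 1.
Proof. exact: (Reval_is_monoid_morphism x y z s t w_idem).1. Qed.

Lemma RevalX P n : ev (P ^+ n) = ev P ^+ n.
Proof. by elim: n => [|n IH]; rewrite ?Reval1 // !exprS RevalM IH. Qed.

Lemma RevalB1 P : ev (P - 1) = ev P - 1.
Proof. by rewrite -Reval1 /Reval /= rmorphB hornerD hornerN. Qed.

(* Generic in its factors, because deciding that [varX], ..., [varT] are different
   makes the unification of [rewrite] unfold polynomial arithmetic. *)
Let Reval_monomial P Q U V W Z p q u v o r i j k l m n :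
  ev P = p -> ev Q = q -> ev U = u -> ev V = v -> ev W = o -> ev Z = r ->
  ev (P ^+ i * Q ^+ j * U ^+ k * V ^+ l * W ^+ m * Z ^+ n) =
  p ^+ i * q ^+ j * u ^+ k * v ^+ l * o ^+ m * r ^+ n.
Proof. by move=> <- <- <- <- <- <-; rewrite !RevalM !RevalX. Qed.

Lemma Reval_Rpoly_term i j k l m n :
  ev ((varX - 1) ^+ i * (varY - 1) ^+ j * varZ ^+ k * varS ^+ l * varW ^+ m *
      varT ^+ n) =
  (x - 1) ^+ i * (y - 1) ^+ j * z ^+ k * s ^+ l * w ^+ m * t ^+ n.
Proof.
apply: Reval_monomial; [| | exact: Reval_varZ | exact: Reval_varS
  | exact: Reval_varW | exact: Reval_varT].
  by apply: etrans (RevalB1 varX) _; rewrite Reval_varX.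
by apply: etrans (RevalB1 varY) _; rewrite Reval_varY.
Qed.

End Evaluation.

(** For [A = cut B], the letters stand for [r = r(A)], [p = r(G) - r(A)], [q = n(A)], [i = n(G)],
    [j = #|B|], [k = k(G)], [f = F_int(A)], and [s] for the exponent of [Z]. The first equation
    counts the edges of [G] in two ways, less [r(A)]; the second uses [k(A) = k(G) + p]. *)
Lemma monomial_specialization (R : comUnitRingType) (alpha eta a : R)
    (r p q i j k f s : nat) :
  alpha \is a GRing.unit -> eta \is a GRing.unit -> a \is a GRing.unit ->
  (j + q = i + p)%N -> (f + s = k + p + q)%N ->
  alpha ^+ (r + q) * eta ^+ j * a ^+ f =
  alpha ^+ (r + p) * eta ^+ i * a ^+ k *
    ((eta * a / alpha) ^+ p * (alpha * a / eta) ^+ q * a^-1 ^+ s).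
Proof.
move=> Ua Ue U jq fs.
have Va := divrr (unitrX p Ua).
(* Cancelling factors are inserted so that the sums [j + q] and [f + s] appear as exponents and can
   be replaced. *)
transitivity (alpha ^+ r * alpha ^+ q * (eta ^+ (j + q) / eta ^+ q) *
    (a ^+ (f + s) / a ^+ s) * (alpha ^+ p / alpha ^+ p)).
  by rewrite Va (exprD _ j q) (exprD _ f s) !mulrK ?unitrX // mulr1 exprD.
by rewrite jq fs !exprMn !exprVn !exprD; ring.
Qed.

Theorem theorem8 (G : ribbon_graph) (R : comUnitRingType)
    (a b d alpha eta : R) (alphas etas : mvertex (medial G) -> R)
    (alphas_const : forall v, alphas v = alpha)
    (etas_const : forall v, etas v = eta)
    (alpha_unit : alpha \is a GRing.unit)
    (eta_unit : eta \is a GRing.unit)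
    (a_unit : a \is a GRing.unit) :
  Qpoly alphas etas a b d =
    alpha ^+ rank G * eta ^+ nullity G * a ^+ ncomp G *
    Reval (eta * a / alpha + 1) (alpha * a / eta + 1) a^-1 d 1 b (Rpoly G).
Proof.
have w_idem : (1 : R) ^+ 2 = 1 by rewrite expr1n.
rewrite /Rpoly Reval_sum mulr_sumr /Qpoly /transition.
(* States list the uncut edges and [Rpoly] sums over the cut ones, hence the complement. *)
rewrite (reindex_inj (@setC_inj (edge G))); apply: eq_bigr => B _ /=.
rewrite Reval_Rpoly_term // !addrK expr1n mulr1.
rewrite nclosed_cut nopen_cut npunctured_cut.
have -> : state_weight alphas etas (~: B) =
    alpha ^+ (rank (cut B) + nullity (cut B)) * eta ^+ #|B|.
  rewrite edges_cut /state_weight (bigID (mem (~: B))) /=; congr (_ * _).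
    by rewrite -prodr_const; apply: eq_bigr => v ->.
  rewrite -prodr_const; apply: eq_big => [v | v /negPf ->] //.
  by rewrite inE negbK.
have cardE := cardsC B; have EB := edges_cut B; have rG := rank_leq_edges G.
have rB := rank_cut B; have FB := nint_faces_cut B.
have kG := leq_ncomp_vertex G; have kB := leq_ncomp_vertex (cut B).
have kGB := leq_ncomp_cut B.
(* The exponent [rank G] is split as [r + p] to match [monomial_specialization]; the powers of [d]
   and [b] are set aside. *)
rewrite [RHS](_ : _ = alpha ^+ (rank (cut B) + (rank G - rank (cut B))) *
    eta ^+ nullity G * a ^+ ncomp G *
    ((eta * a / alpha) ^+ (rank G - rank (cut B)) *
     (alpha * a / eta) ^+ nullity (cut B) *
     a^-1 ^+ (ncomp (cut B) + nullity (cut B) - nint_faces (cut B))) *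
    (d ^+ nboundary_comp (cut B) * b ^+ nhalf_ribbons (cut B))); last first.
  by rewrite subnKC // !mulrA.
rewrite -(@monomial_specialization R alpha eta a _ _ _ _ #|B| _ (nint_faces (cut B))) //.
- by rewrite [RHS]mulrA mulrAC.
- by rewrite {2}/nullity; lia.
- by rewrite subnKC // /rank; move: kG kB kGB => /=; lia.
Qed.
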